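(* For every pair of integers $1\le K\le N$ (with $N\ge2$) and for every $\eta>0$, there exists a family-wise critical point with respect to $\{\Phi^{\alpha,\beta,\delta,\eta}\}_{\alpha,\beta,\delta\in(0,\infty)}$ on $\mathcal M_{N,K}$; that is, there exists $G\in\mathcal M_{N,K}$ with $\nabla\Phi^{\alpha,\beta,\delta,\eta}(G)=0$ for all $\alpha,\beta,\delta\in(0,\infty)$.
   Context: Let $\mathbb F=\mathbb R$ or $\mathbb C$. $\mathcal M_{N,K}=\{G\in\mathbb F^{N\times N}: G=G^2=G^*,\ \mathrm{tr}(G)=K\}$, regarded as a real analytic submanifold of the Hermitian (resp. symmetric) matrices with the Riemannian metric $X\cdot Y=\mathrm{tr}(XY)$; $\nabla$ is the corresponding Riemannian gradient on $\mathcal M_{N,K}$. Indices lie in $\mathbb Z_N$ (so $x+1$ is taken modulo $N$). $C_{N,K}=\sqrt{\frac{K(N-K)}{N^2(N-1)}}$. For $G=(G_{a,b})\in\mathcal M_{N,K}$ and $\alpha,\beta,\delta,\eta>0$: - $\Phi_{sum}^\eta(G)=\sum_{j\ne l}e^{\eta|G_{j,l}|^2}+\sum_{j=1}^N e^{-\eta(K^2/N^2-C_{N,K}^2)}e^{\eta|G_{j,j}|^2}$; - $\Phi_{diag}^\delta(G)=\frac1\delta\sum_{j=1}^N e^{\delta|G_{j,j}|^2}-\frac N\delta e^{\delta K^2/N^2}$; - $R_x^{\alpha,\beta}(G)=\frac1\alpha\sum_{j\ne x}e^{\alpha|G_{x,j}|^2}+\beta e^{|G_{x,x}|^2}$ for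 $x\in\mathbb Z_N$; - $\Phi_{ch}^{\alpha,\beta}(G)=\sum_{x\in\mathbb Z_N}\left(R_x^{\alpha,\beta}(G)-R_{x+1}^{\alpha,\beta}(G)\right)^2$; - $\Phi^{\alpha,\beta,\delta,\eta}(G)=\Phi_{ch}^{\alpha,\beta}(G)+\Phi_{diag}^\delta(G)+\Phi_{sum}^\eta(G)$. *)

(* Defs.v *)
From HB Require Import structures.
From mathcomp Require Import all_boot all_order all_algebra.
From mathcomp Require Import all_classical all_reals all_analysis.
From mathcomp Require Import complex ring.

Set Implicit Arguments.
Unset Strict Implicit.
Unset Printing Implicit Defensive.

Import Order.TTheory GRing.Theory Num.Theory.
Import numFieldNormedType.Exports.

Local Open Scope classical_set_scope.
Local Open Scope ring_scope.

(* The two possibilities for the base field F, so that "F = R or C" is a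
   quantification over a two-element type. *)
Inductive base_field : Type := RealField | ComplexField.

Section Scalars.
Variable R : realType.

Definition scalarF (k : base_field) : numFieldType :=
  match k with RealField => R | ComplexField => R[i] end.

Definition conjF (k : base_field) : scalarF k -> scalarF k :=
  match k with
  | RealField => fun x => x
  | ComplexField => fun z => conjc z
  end.

Definition reF (k : base_field) : scalarF k -> R :=
  match k with
  | RealField => fun x => x
  | ComplexField => fun z => complex.Re z
  end.

Definition imF (k : base_field) : scalarF k -> R :=
  match k with
  | RealField => fun _ => 0
  | ComplexField => fun z => complex.Im z
  end.

(* The norm of a numFieldType takes values in the field itself; on R[i] these
   values are real, and reF brings them back to R. *)
Definition absF (k : base_field) (z : scalarF k) : R := reF `|z|.

End Scalars.

Section Grassmannian.
Variables (R : realType) (k : base_field) (N K : nat).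
Local Notation F := (scalarF R k).

Definition adjointmx (A : 'M[F]_N) : 'M[F]_N := (map_mx (@conjF R k) A)^T.

Definition Gr : set 'M[F]_N :=
  [set G | [/\ G *m G = G, adjointmx G = G & \tr G = K%:R]].

Definition smooth (f : R -> R) : Prop :=
  forall (n : nat) (t : R), derivable (f^`(n))%classic t 1.

Definition smooth_curve (g : R -> 'M[F]_N) : Prop :=
  (forall t, Gr (g t)) /\
  (forall a b, smooth (fun t => reF (g t a b)) /\
               smooth (fun t => imF (g t a b))).

Definition velocity0 (g : R -> 'M[F]_N) (X : 'M[F]_N) : Prop :=
  forall a b, is_derive (0 : R) 1 (fun t => reF (g t a b)) (reF (X a b)) /\
              is_derive (0 : R) 1 (fun t => imF (g t a b)) (imF (X a b)).

Definition tangent_space (G : 'M[F]_N) : set 'M[F]_N :=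
  [set X | exists g, [/\ smooth_curve g, g 0 = G & velocity0 g X]].

(* tr(XY) is real for self-adjoint X and Y, in particular for tangent vectors;
   reF only changes its type from F to R. *)
Definition metric (X Y : 'M[F]_N) : R := reF (\tr (X *m Y)).

(* V is the Riemannian gradient at G of the restriction of f to Gr: V is
   tangent at G and d f_G(X) = <V, X> for every tangent vector X, where
   d f_G(X) is computed along the curves with velocity X.  Such a V is unique
   (riemannian_gradient_unique). *)
Definition riemannian_gradient (f : 'M[F]_N -> R) (G V : 'M[F]_N) : Prop :=
  tangent_space G V /\
  forall g X, smooth_curve g -> g 0 = G -> velocity0 g X ->
    is_derive (0 : R) 1 (fun t => f (g t)) (metric V X).

End Grassmannian.

Section Potentials.
Variables (R : realType) (k : base_field) (N K : nat).
Local Notation F := (scalarF R k).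
Implicit Types (G : 'M[F]_N) (x : 'I_N).

Definition C_NK : R :=
  Num.sqrt (K%:R * (N%:R - K%:R) / (N%:R ^+ 2 * (N%:R - 1))).

Definition Phi_sum (eta : R) G : R :=
  \sum_(j < N) \sum_(l < N | j != l) expR (eta * absF (G j l) ^+ 2)
  + \sum_(j < N) expR (- eta * (K%:R ^+ 2 / N%:R ^+ 2 - C_NK ^+ 2))
                 * expR (eta * absF (G j j) ^+ 2).

Definition Phi_diag (delta : R) G : R :=
  delta^-1 * (\sum_(j < N) expR (delta * absF (G j j) ^+ 2))
  - N%:R / delta * expR (delta * (K%:R ^+ 2 / N%:R ^+ 2)).

Definition R_row (alpha beta : R) G x : R :=
  alpha^-1 * (\sum_(j < N | j != x) expR (alpha * absF (G x j) ^+ 2))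
  + beta * expR (absF (G x x) ^+ 2).

(* ordS x is x + 1 modulo N. *)
Definition Phi_ch (alpha beta : R) G : R :=
  \sum_(x < N) (R_row alpha beta G x - R_row alpha beta G (ordS x)) ^+ 2.

Definition Phi (alpha beta delta eta : R) G : R :=
  Phi_ch alpha beta G + Phi_diag delta G + Phi_sum eta G.

End Potentials.

Section GradientUnique.
Variables (R : realType) (k : base_field) (N K : nat).
Local Notation F := (scalarF R k).

Lemma metricE (X Y : 'M[F]_N) :
  metric X Y =
  \sum_a \sum_b (reF (X a b) * reF (Y b a) - imF (X a b) * imF (Y b a)).
Proof.
have reD (I : finType) (E : I -> F) : reF (\sum_i E i) = \sum_i reF (E i).
  apply: (big_morph (@reF R k)).
    by case: k => //= -[a b] [c d].
  by case: k.
rewrite /metric /mxtrace reD; apply: eq_bigr => a _.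
rewrite mxE reD; apply: eq_bigr => b _.
move: (X a b) (Y b a); case: k => [x y|[x1 x2] [y1 y2]] //=.
by rewrite mulr0 subr0.
Qed.

Lemma tangent_selfadjoint (G X : 'M[F]_N) : tangent_space K G X ->
  forall a b, reF (X a b) = reF (X b a) /\ imF (X a b) = - imF (X b a).
Proof.
move=> [g [[gGr _] _ vX]] a b.
have adj t : g t a b = conjF (g t b a).
  by have [_ /matrixP/(_ a b) <- _] := gGr t; rewrite !mxE.
have reE : (fun t => reF (g t a b)) = (fun t => reF (g t b a)).
  by apply/funext => t; rewrite adj; move: (g t b a); case: k => //= -[].
have imE : (fun t => imF (g t a b)) = - (fun t => imF (g t b a)).
  apply/funext => t; rewrite adj opprfctE; move: (g t b a).
  by case: k => [x|[x y]] //=; rewrite oppr0.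
have [d1 d2] := vX a b; have [d3 d4] := vX b a.
split; first by rewrite -(@derive_val _ _ _ _ _ _ _ d1) reE derive_val.
by rewrite -(@derive_val _ _ _ _ _ _ _ d2) imE derive_val.
Qed.

Lemma riemannian_gradient_unique (f : 'M[F]_N -> R) (G V W : 'M[F]_N) :
  riemannian_gradient K f G V -> riemannian_gradient K f G W -> V = W.
Proof.
move=> [TV dV] [TW dW].
have eqm X : tangent_space K G X -> metric V X = metric W X.
  move=> [g [sg g0 vX]].
  rewrite -(@derive_val _ _ _ _ _ _ _ (dV _ _ sg g0 vX)).
  by rewrite (@derive_val _ _ _ _ _ _ _ (dW _ _ sg g0 vX)).
have hV := tangent_selfadjoint TV; have hW := tangent_selfadjoint TW.
have : \sum_a \sum_b ((reF (V a b) - reF (W a b)) ^+ 2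
                    + (imF (V a b) - imF (W a b)) ^+ 2) = 0.
  transitivity (metric V V - metric W V - (metric V W - metric W W)).
    rewrite !metricE -!sumrB; apply: eq_bigr => a _.
    rewrite -!sumrB; apply: eq_bigr => b _.
    have [-> ->] := hV b a; have [-> ->] := hW b a.
    by rewrite !mulrN !opprK !expr2; ring.
  by rewrite (eqm _ TV) (eqm _ TW) !subrr.
have ge0 a b : 0 <= (reF (V a b) - reF (W a b)) ^+ 2
                    + (imF (V a b) - imF (W a b)) ^+ 2.
  by rewrite addr_ge0 ?sqr_ge0.
move=> /psumr_eq0P s0; apply/matrixP => a b.
have /psumr_eq0P t0 := s0 (fun i _ => sumr_ge0 _ (fun j _ => ge0 i j)) a isT.
have /eqP := t0 (fun j _ => ge0 a j) b isT.
rewrite paddr_eq0 ?sqr_ge0// !sqrf_eq0 !subr_eq0 => /andP[/eqP + /eqP].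
by move: (V a b) (W a b); case: k => //= -[x y] [x' y'] /= -> ->.
Qed.

End GradientUnique.

(* Main.v *)
Require Import Defs.
From HB Require Import structures.
From mathcomp Require Import all_boot all_order all_algebra.
From mathcomp Require Import separable cyclic cyclotomic.
From mathcomp Require Import all_classical all_reals all_analysis.
From mathcomp Require Import finset complex ring.

Set Implicit Arguments.
Unset Strict Implicit.
Unset Printing Implicit Defensive.

Import Order.TTheory GRing.Theory Num.Theory.

Local Open Scope ring_scope.

(** The critical point is a real symmetric circulant projection [A] of rank
    [K]: [A a b] depends only on [a - b] in Z/N.  One and the same [A] works
    for both fields and for all parameters.

    Existence ([circulant_projection_exists]).  The circulant orthogonal
    projections are exactly the spectral projections of the cyclic shift, one
    for each set [S] of characters of Z/N, with rank [#|S|].  The projection is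
    real as soon as [S = - S], and a finite abelian group has such subsets of
    every cardinality ([symmetric_subset]).

    Criticality.  A tangent vector [Y] at [A] satisfies [Y = A Y + Y A], that
    is, it has no diagonal blocks with respect to the splitting into the image
    and the kernel of [A]; hence it is orthogonal to every matrix that commutes
    with [A] ([commuting_orthogonal_tangent]).  Both [Phi_sum] and [Phi_diag]
    are, up to a constant, sums of [w (a - b) * exp (c * |G a b|^2)]; at the
    point [A] the Euclidean gradient of such a sum is again circulant,
    therefore commutes with [A], and its derivative along every curve vanishes
    ([circulant_energy_critical]).  Finally [Phi_ch] is a sum of squares of
    differences [R_x - R_(x+1)], which are zero at [A] by the invariance under
    the shift, so its derivative vanishes as well ([Phi_ch_critical]). *)

(** * Real circulant projections of every rank *)

(** Induction by steps of two: outside of [S] there is either a pair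
    [{x, - x}] with [x != - x], or two elements equal to their opposites, and
    adding the two elements keeps [S] symmetric. *)
Lemma symmetric_subset (V : finZmodType) (K : nat) : (K <= #|V|)%N ->
  exists S : {set V}, #|S| = K /\ forall s, (- s \in S) = (s \in S).
Proof.
elim/ltn_ind: K => -[|[|K]] IH leK.
- by exists set0; rewrite cards0; split=> // s; rewrite !inE.
- by exists [set 0]; rewrite cards1; split=> // s; rewrite !inE oppr_eq0.
have [|S [cS oS]] := IH K (leqW (leqnn _)).
  exact: leq_trans (leqW (leqW (leqnn _))) leK.
have oC s : (- s \in ~: S) = (s \in ~: S) by rewrite !inE oS.
have addS x y : x \in ~: S -> y \in ~: S -> x != y ->
    (forall s, (- s \in [set x; y]) = (s \in [set x; y])) ->
  exists T : {set V}, #|T| = K.+2 /\ forall s, (- s \in T) = (s \in T).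
  move=> xS yS xy oxy; exists ([set x; y] :|: S); split; last first.
    by move=> s; rewrite in_setU [RHS]in_setU oS oxy.
  rewrite cardsU cards2 xy cS (_ : _ :&: _ = set0) ?cards0 ?subn0//.
  by apply/setP => s; rewrite !inE; case: eqP => [->|_];
    [|case: eqP => [->|//]]; apply/negbTE; rewrite -in_setC.
have : (1 < #|~: S|)%N by rewrite cardsCs setCK cS ltn_subRL addn1.
case/card_gt1P => x [y] [xS yS xy].
have [xx|xx] := eqVneq x (- x); last first.
  apply: (addS x (- x)); rewrite ?oC// => s; rewrite !inE eqr_oppLR.
  by rewrite eqr_opp orbC.
have [yy|yy] := eqVneq y (- y); last first.
  apply: (addS y (- y)); rewrite ?oC// => s; rewrite !inE eqr_oppLR.
  by rewrite eqr_opp orbC.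
by apply: (addS x y) => // s; rewrite !inE !eqr_oppLR -xx -yy.
Qed.

Lemma primitive_root_exists (C : closedFieldType) (n : nat) :
  n%:R != 0 :> C -> exists z : C, n.-primitive_root z.
Proof.
move=> nC0; have n_gt0 : (0 < n)%N by case: n nC0 => //; rewrite eqxx.
have [r] := closed_field_poly_normal ('X^n - 1 : {poly C}).
rewrite (monicP (monicXnsubC 1 n_gt0)) scale1r => rP.
have r_uniq : uniq r.
  by rewrite -separable_prod_XsubC -rP separable_Xn_sub_1.
have r_size : size r = n.
  by apply: succn_inj; rewrite -(size_prod_XsubC r id) -rP size_XnsubC.
have r_unity : all n.-unity_root r.
  by apply/allP => z; rewrite -root_prod_XsubC -rP.
have /hasP[z _ z_prim] := has_prim_root n_gt0 r_unity r_uniq (eq_leq (esym r_size)).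
by exists z.
Qed.

Section Circulant.
Variables (F : comNzRingType) (n : nat).
Implicit Types (A M Y : 'M[F]_n.+2).

Definition circulant A := forall a b c, A (a + c) (b + c) = A a b.

(** Convolution on an abelian group is commutative: the substitution
    [c -> a + b - c] exchanges the two factors. *)
Lemma circulant_comm A M : circulant A -> circulant M -> M *m A = A *m M.
Proof.
move=> cA cM; apply/matrixP => a b; rewrite !mxE.
rewrite (reindex_inj (h := fun c => a + b - c)) /=; last first.
  by move=> c d /addrI /oppr_inj.
apply: eq_bigr => c _; rewrite mulrC; congr (_ * _).
  by rewrite -(cA a c (b - c)) addrA (addrC c) subrK.
by rewrite -(cM c b (a - c)) (addrC c) subrK addrA (addrC b).
Qed.

End Circulant.

(** The relation [Y = A Y + Y A] forces [A Y A = 0]; since [M] commutes with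
    [A], both traces [tr (M A Y)] and [tr (M Y A)] reduce to
    [tr (M (A Y A))]. *)
Lemma commuting_orthogonal_tangent (F : comNzRingType) (n : nat)
    (A M Y : 'M[F]_n) :
  A *m A = A -> Y = A *m Y + Y *m A -> M *m A = A *m M -> \tr (M *m Y) = 0.
Proof.
move=> AA dY MA.
have AYA : A *m Y *m A = 0.
  apply: (addrI (A *m Y *m A)); rewrite addr0 [in RHS]dY.
  by rewrite mulmxDr mulmxDl !mulmxA AA -!mulmxA AA.
have trl : \tr (M *m (A *m Y)) = 0.
  rewrite -AA -(mulmxA A) mulmxA MA -mulmxA mxtrace_mulC.
  by rewrite -!mulmxA (mulmxA A Y) AYA mulmx0 mxtrace0.
have trr : \tr (M *m (Y *m A)) = 0.
  rewrite -AA !mulmxA mxtrace_mulC !mulmxA -MA.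
  by rewrite -!mulmxA (mulmxA A Y) AYA mulmx0 mxtrace0.
by rewrite dY mulmxDr mxtraceD trl trr addr0.
Qed.

Section FourierProjection.
Variables (R : realType) (n : nat) (w : R[i]) (S : {set 'I_n.+2}).
Hypothesis w_prim : n.+2.-primitive_root w.
Hypothesis oppS : forall s, (- s \in S) = (s \in S).
Local Notation N := n.+2.

(** As [w] has order [N], this is a character of Z/N, and [chi (s * c)] runs
    over all the characters as [s] varies. *)
Definition chi (u : 'I_N) : R[i] := w ^+ u.

Lemma chiD (u v : 'I_N) : chi (u + v) = chi u * chi v.
Proof. by rewrite /chi -exprD -[RHS](prim_expr_mod w_prim). Qed.

Lemma chi0 : chi 0 = 1. Proof. by []. Qed.

(** For [u != 0] the sum is invariant under multiplication by [chi u], which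
    differs from 1. *)
Lemma chi_orthogonal (u : 'I_N) :
  \sum_(c < N) chi (u * c) = if u == 0 then N%:R else 0.
Proof.
case: eqP => [->|/eqP u0].
  under eq_bigr do rewrite mul0r chi0.
  by rewrite sumr_const card_ord.
have chiu : chi u != 1.
  by rewrite /chi -(prim_order_dvd w_prim) gtnNdvd// lt0n.
apply: (mulIf (x := chi u - 1)); first by rewrite subr_eq0.
rewrite mul0r mulrBr mulr1 mulr_suml; apply/eqP; rewrite subr_eq0; apply/eqP.
rewrite [RHS](reindex_inj (addIr 1)) /=.
by apply: eq_bigr => c _; rewrite mulrDr mulr1 chiD.
Qed.

(** The kernel [N^-1 chi (s * (a - b))] projects onto the line spanned by the
    character of index [s]. *)
Definition spectral_proj : 'M[R[i]]_N :=
  \matrix_(a, b) (N%:R^-1 * \sum_(s in S) chi (s * (a - b))).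

Lemma spectral_proj_circulant : circulant spectral_proj.
Proof. by move=> a b c; rewrite !mxE opprD addrACA subrr addr0. Qed.

Lemma spectral_proj_sym a b : spectral_proj b a = spectral_proj a b.
Proof.
rewrite !mxE (reindex_inj oppr_inj) /=; congr (_ * _).
by apply: eq_big => s; rewrite ?oppS// mulNr -mulrN opprB.
Qed.

Lemma spectral_proj_trace : \tr spectral_proj = #|S|%:R.
Proof.
rewrite /mxtrace; under eq_bigr => a _.
  rewrite mxE subrr; under eq_bigr do rewrite mulr0 chi0.
  over.
by rewrite !sumr_const card_ord -[RHS]mul1r -mulrnAl -mulr_natr mulVf ?pnatr_eq0.
Qed.

Lemma spectral_proj_idem : spectral_proj *m spectral_proj = spectral_proj.
Proof.
have Nn0 : N%:R != 0 :> R[i] by rewrite pnatr_eq0.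
apply/matrixP => a b; rewrite !mxE.
transitivity (N%:R^-1 * (N%:R^-1 * \sum_(s in S) \sum_(t in S)
    chi (s * a - t * b) * \sum_(c < N) chi ((t - s) * c))).
  under eq_bigr => c _ do rewrite !mxE mulrACA -mulrA big_distrlr /=.
  rewrite -!mulr_sumr; congr (_ * (_ * _)).
  rewrite exchange_big /=; apply: eq_bigr => s _.
  rewrite exchange_big /=; apply: eq_bigr => t _.
  rewrite mulr_sumr; apply: eq_bigr => c _.
  by rewrite -!chiD; congr (chi _); ring.
congr (_ * _); rewrite mulr_sumr; apply: eq_bigr => s sS.
rewrite (bigD1 s)//= [X in _ + X]big1.
  by rewrite chi_orthogonal subrr eqxx addr0 mulrC mulfK// mulrBr.
move=> t /andP[_ ts].
by rewrite chi_orthogonal subr_eq0 (negPf ts) mulr0.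
Qed.

(** The values of [chi] are roots of unity, so conjugation inverts them. *)
Lemma conj_chi (u : 'I_N) : (chi u)^*%C = chi (- u).
Proof.
have w1 : `|w| = 1.
  apply/eqP; rewrite -(@pexpr_eq1 _ _ N)// -normrX.
  by rewrite (prim_expr_order w_prim) normr1.
have chi_unit : chi u != 0 by rewrite expf_neq0// -normr_eq0 w1 oner_eq0.
apply: (mulfI chi_unit); rewrite -chiD subrr chi0.
have := normCK (chi u); rewrite /chi normrX w1 !expr1n => ->.
by [].
Qed.

(** Conjugation replaces [S] by [- S], that is, transposes the matrix, which
    is symmetric. *)
Lemma spectral_proj_real a b :
  spectral_proj a b = (complex.Re (spectral_proj a b))%:C%C.
Proof.
have : (spectral_proj a b)^*%C = spectral_proj a b.
  rewrite -[RHS]spectral_proj_sym !mxE rmorphM rmorph_sum /=.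
  rewrite conjc_inv conjc_nat; congr (_ * _); apply: eq_bigr => s _.
  by rewrite conj_chi -mulrN opprB.
case: (spectral_proj a b) => x y /= [yy].
have : y *+ 2 == 0 by rewrite mulr2n -{1}yy addNr.
by rewrite mulrn_eq0 /= => /eqP ->.
Qed.
End FourierProjection.

Lemma circulant_projection_exists (R : realType) (n K : nat) :
  (K <= n.+2)%N ->
  exists A : 'M[R]_n.+2,
    [/\ A *m A = A, A^T = A, \tr A = K%:R & circulant A].
Proof.
move=> leK.
have [S [cS oS]] : exists S : {set 'I_n.+2},
    #|S| = K /\ forall s, (- s \in S) = (s \in S).
  by apply: symmetric_subset; rewrite card_ord.
have [w w_prim] : exists w : R[i], n.+2.-primitive_root w.
  by apply: primitive_root_exists; rewrite pnatr_eq0.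
pose B := spectral_proj w S.
pose A := map_mx (@complex.Re R) B.
have BA : B = map_mx (real_complex R) A.
  rewrite -map_mx_comp; apply/matrixP => a b; rewrite [RHS]mxE.
  exact: (spectral_proj_real w_prim).
exists A; split.
- apply: (map_mx_inj (f := real_complex R)).
  by rewrite map_mxM -BA spectral_proj_idem.
- by apply/matrixP => a b; rewrite [LHS]mxE [LHS]mxE [RHS]mxE spectral_proj_sym.
- apply: (fmorph_inj (real_complex R)).
  by rewrite -trace_map_mx -BA spectral_proj_trace// cS rmorph_nat.
- by move=> a b c; rewrite [LHS]mxE [RHS]mxE spectral_proj_circulant.
Qed.

(** * Curves of projections through a real circulant point *)

Section Scalars.
Variables (R : realType) (k : base_field).

(** The inclusion of R into either base field, as a single morphism, so that
    the two cases share one proof. *)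
Definition ofR : R -> scalarF R k :=
  match k with RealField => id | ComplexField => real_complex R end.

Lemma ofR_is_additive : {morph ofR : x y / x - y}.
Proof. by rewrite /ofR; case: k => // x y; rewrite rmorphB. Qed.

Lemma ofR_is_multiplicative : monoid_morphism ofR.
Proof. by rewrite /ofR; case: k; split=> // x y; rewrite rmorphM. Qed.

HB.instance Definition _ := GRing.isZmodMorphism.Build R (scalarF R k) ofR
  ofR_is_additive.
HB.instance Definition _ := GRing.isMonoidMorphism.Build R (scalarF R k) ofR
  ofR_is_multiplicative.

Lemma reF_ofR x : reF (ofR x) = x. Proof. by rewrite /ofR; case: k. Qed.
Lemma imF_ofR x : imF (ofR x) = 0. Proof. by rewrite /ofR; case: k. Qed.
Lemma conjF_ofR x : conjF (ofR x) = ofR x.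
Proof. by rewrite /ofR; case: k => //=; rewrite oppr0. Qed.

Lemma sqr_absF (z : scalarF R k) : absF z ^+ 2 = reF z ^+ 2 + imF z ^+ 2.
Proof.
rewrite /absF; move: z; case: k => [z|[x y]] /=.
  by rewrite expr0n addr0 real_normK// num_real.
by rewrite sqr_sqrtr// addr_ge0 ?sqr_ge0.
Qed.

Lemma reF_sum (I : finType) (E : I -> scalarF R k) :
  reF (\sum_i E i) = \sum_i reF (E i).
Proof.
apply: (big_morph (@reF R k)); last by case: k.
by case: k => //= -[a b] [c d].
Qed.

Lemma reFM (x y : scalarF R k) : reF (x * y) = reF x * reF y - imF x * imF y.
Proof. by move: x y; case: k => [x y|[a b] [c d]] //=; rewrite mulr0 subr0. Qed.

End Scalars.

Section RealDerivatives.
Variable R : realType.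
Implicit Types (f g : R -> R) (x : R).

Lemma is_derive_sum_cond (I : finType) (P : pred I) (h : I -> R -> R)
    (dh : I -> R) x :
  (forall i, is_derive x 1 (h i) (dh i)) ->
  is_derive x 1 (fun t => \sum_(i | P i) h i t) (\sum_(i | P i) dh i).
Proof.
move=> dF.
rewrite (_ : (fun t => _) = \sum_(i | P i) h i); last first.
  by apply/funext => t; rewrite fct_sumE.
by elim/big_ind2 : _ => // [|] *; [exact: is_derive_cst|exact: is_deriveD].
Qed.

Lemma is_derive_mul f g x (df dg : R) :
  is_derive x 1 f df -> is_derive x 1 g dg ->
  is_derive x 1 (fun t => f t * g t) (f x * dg + g x * df).
Proof. by move=> hf hg; exact: (is_deriveM hf hg). Qed.

Lemma is_derive_sqr f x (df : R) :
  is_derive x 1 f df -> is_derive x 1 (fun t => f t ^+ 2) (2 * f x * df).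
Proof.
move=> hf; apply: is_derive_eq (is_derive_mul hf hf) _.
by ring.
Qed.

Lemma is_derive_scaled_exp f x (w c df : R) : is_derive x 1 f df ->
  is_derive x 1 (fun t => w * expR (c * f t)) (w * c * expR (c * f x) * df).
Proof.
move=> hf; have hc : is_derive x 1 (fun t => c * f t) (c * df).
  by apply: is_derive_eq (is_deriveZ c hf) _.
have he := @is_derive1_comp _ expR (fun t => c * f t) x _ _ (is_derive_expR (c * f x)) hc.
apply: is_derive_eq (is_deriveZ w he) _.
by rewrite /GRing.scale /=; ring.
Qed.

End RealDerivatives.

Section Curve.
Variables (R : realType) (k : base_field) (n K : nat).
Local Notation N := n.+2.
Variable A : 'M[R]_N.
Hypotheses (A_idem : A *m A = A) (A_circ : circulant A).
Local Notation G := (map_mx (@ofR R k) A).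
Variables (g : R -> 'M[scalarF R k]_N) (X : 'M[scalarF R k]_N).
Hypotheses (g_curve : smooth_curve K g) (g0 : g 0 = G) (gX : velocity0 g X).

Let Y : 'M[R]_N := map_mx (@reF R k) X.

(** The imaginary part of the velocity has no effect to first order, since
    the entries of [g 0] are real. *)
Lemma sqr_entry_derive a b :
  is_derive (0 : R) 1 (fun t => absF (g t a b) ^+ 2) (2 * A a b * Y a b).
Proof.
have [dre dim] := gX a b.
rewrite (_ : (fun t => _) =
    (fun t => reF (g t a b) ^+ 2) + (fun t => imF (g t a b) ^+ 2)); last first.
  by apply/funext => t; rewrite sqr_absF.
apply: is_derive_eq (is_deriveD (is_derive_sqr dre) (is_derive_sqr dim)) _.
by rewrite g0 !mxE reF_ofR imF_ofR mulr0 mul0r addr0.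
Qed.

(** The common form of [Phi_sum] and [Phi_diag]: the weight [w] may
    single out the diagonal, which is the class [a - b = 0]. *)
Definition circulant_energy (w : 'I_N -> R) (c : R)
    (H : 'M[scalarF R k]_N) : R :=
  \sum_a \sum_b w (a - b) * expR (c * absF (H a b) ^+ 2).

(** Differentiate the identity [g t *m g t = g t] at 0 and take real parts;
    the products of imaginary parts drop out because [g 0] is real. *)
Lemma curve_tangent : Y = A *m Y + Y *m A.
Proof.
have [gGr _] := g_curve.
apply/matrixP => a b; have [dY _] := gX a b.
have dprod : is_derive (0 : R) 1 (fun t => reF (g t a b))
    (\sum_c (A a c * Y c b + Y a c * A c b)).
  rewrite (_ : (fun t => _) = fun t => \sum_c
      (reF (g t a c) * reF (g t c b) - imF (g t a c) * imF (g t c b))).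
    apply: is_derive_sum_cond => c.
    have [dr1 di1] := gX a c; have [dr2 di2] := gX c b.
    apply: is_derive_eq
      (is_deriveB (is_derive_mul dr1 dr2) (is_derive_mul di1 di2)) _.
    rewrite g0 !mxE !reF_ofR !imF_ofR; ring.
  apply/funext => t; have [gg _ _] := gGr t.
  by rewrite -[in LHS]gg mxE reF_sum; apply: eq_bigr => c _; rewrite reFM.
rewrite mxE -(@derive_val _ _ _ _ _ _ _ dY) (@derive_val _ _ _ _ _ _ _ dprod).
by rewrite [RHS]mxE !mxE -big_split.
Qed.

Lemma circulant_energy_critical (w : 'I_N -> R) (c : R) :
  is_derive (0 : R) 1 (fun t => circulant_energy w c (g t)) 0.
Proof.
pose M := (\matrix_(a, b) (w (a - b) * c * expR (c * A a b ^+ 2) * A a b))^T.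
have M_circ : circulant M.
  by move=> a b d; rewrite !mxE A_circ opprD addrACA subrr addr0.
have : \tr (M *m Y) = 0.
  exact: commuting_orthogonal_tangent A_idem curve_tangent
    (circulant_comm A_circ M_circ).
move=> trMY; apply: is_derive_eq.
  apply: is_derive_sum_cond => a; apply: is_derive_sum_cond => b.
  apply: is_derive_scaled_exp; exact: sqr_entry_derive.
(* The derivative is the pairing of [Y] with the Euclidean gradient [2 M^T]. *)
transitivity (2 * \tr (M *m Y)); last by rewrite trMY mulr0.
rewrite /mxtrace; under [in RHS]eq_bigr do rewrite mxE.
rewrite exchange_big !mulr_sumr; apply: eq_bigr => a _.
rewrite mulr_sumr; apply: eq_bigr => b _.
rewrite g0 !mxE sqr_absF reF_ofR imF_ofR expr0n addr0; ring.
Qed.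

End Curve.

(** * The three parts of the potential *)

Section Potentials.
Variables (R : realType) (k : base_field) (n K : nat).
Local Notation N := n.+2.
Local Notation F := (scalarF R k).
Implicit Types (G H : 'M[F]_N).

Lemma Phi_sum_energy eta H : Phi_sum K eta H = circulant_energy
  (fun d => if d == 0 then
     expR (- eta * (K%:R ^+ 2 / N%:R ^+ 2 - C_NK R N K ^+ 2)) else 1) eta H.
Proof.
rewrite /Phi_sum /circulant_energy addrC -big_split; apply: eq_bigr => a _ /=.
rewrite [RHS](bigD1 a)//= subrr eqxx; congr (_ + _).
apply: eq_big => [b|b ab]; first by rewrite eq_sym.
by rewrite subr_eq0 (negPf ab) mul1r.
Qed.

Lemma Phi_diag_energy delta H : Phi_diag K delta H =
  circulant_energy (fun d => if d == 0 then delta^-1 else 0) delta H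
  - N%:R / delta * expR (delta * (K%:R ^+ 2 / N%:R ^+ 2)).
Proof.
rewrite /Phi_diag /circulant_energy; congr (_ - _).
rewrite mulr_sumr; apply: eq_bigr => a _.
rewrite [RHS](bigD1 a)//= subrr eqxx big1 ?addr0// => b ab.
by rewrite subr_eq0 eq_sym (negPf ab) mul0r.
Qed.

Lemma circulant_R_row alpha beta G x : circulant G ->
  R_row alpha beta G (ordS x) = R_row alpha beta G x.
Proof.
move=> G_circ.
have -> : ordS x = x + 1 by apply: val_inj; rewrite /= modnDmr addn1.
rewrite /R_row G_circ; congr (_ * _ + _).
rewrite (reindex_inj (addIr 1)) /=; apply: eq_big => j.
  by rewrite (inj_eq (addIr 1)).
by rewrite G_circ.
Qed.

(** Only differentiability matters: in [Phi_ch] the derivative of a row sum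
    is multiplied by a difference that vanishes at the point considered. *)
Lemma R_row_derivable alpha beta (u' : 'I_N -> 'I_N -> R) (g : R -> 'M[F]_N) x :
  (forall a b, is_derive (0 : R) 1 (fun t => absF (g t a b) ^+ 2) (u' a b)) ->
  exists d, is_derive (0 : R) 1 (fun t => R_row alpha beta (g t) x) d.
Proof.
move=> du; eexists.
have doff (j : 'I_N) := is_derive_scaled_exp alpha^-1 alpha (du x j).
have ddiag := is_derive_scaled_exp beta 1 (du x x).
have dsum := is_derive_sum_cond (fun j => j != x) doff.
rewrite (_ : (fun t => _) =
  (fun t => \sum_(j < N | j != x)
     alpha^-1 * expR (alpha * absF (g t x j) ^+ 2)) +
  (fun t => beta * expR (1 * absF (g t x x) ^+ 2))); last first.
  by apply/funext => t; rewrite /R_row mulr_sumr !fctE mul1r.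
exact: is_deriveD dsum ddiag.
Qed.

Lemma Phi_ch_critical alpha beta (u' : 'I_N -> 'I_N -> R) (g : R -> 'M[F]_N) :
  circulant (g 0) ->
  (forall a b, is_derive (0 : R) 1 (fun t => absF (g t a b) ^+ 2) (u' a b)) ->
  is_derive (0 : R) 1 (fun t => Phi_ch alpha beta (g t)) 0.
Proof.
move=> g0_circ du.
pose D x t := R_row alpha beta (g t) x - R_row alpha beta (g t) (ordS x).
have dD x : is_derive (0 : R) 1 (fun t => D x t ^+ 2) 0.
  have [d1 h1] := R_row_derivable alpha beta x du.
  have [d2 h2] := R_row_derivable alpha beta (ordS x) du.
  apply: is_derive_eq (is_derive_sqr (is_deriveB h1 h2)) _.
  by rewrite !fctE circulant_R_row// subrr mulr0 mul0r.
by apply: is_derive_eq (is_derive_sum_cond xpredT dD) _; rewrite big1.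
Qed.

(** The velocity of the constant curve. *)
Lemma tangent_space0 G : Gr K G -> tangent_space K G 0.
Proof.
move=> GrG; exists (fun=> G); split=> //.
  have smooth_cst (c : R) : smooth (fun=> c).
    move=> m t; suff [d ->] : exists d : R, derive1n m (fun=> c) = cst d by [].
    elim: m => [|m [d IH]]; first by exists c.
    by exists 0; apply/funext => s; rewrite derive1nS IH derive1_cst.
  by split=> // a b; split; exact: smooth_cst.
have [re0 im0] : reF (0 : F) = 0 /\ imF (0 : F) = 0 by case: (k).
by move=> a b; rewrite mxE re0 im0; split; exact: is_derive_cst.
Qed.

End Potentials.

Theorem corollary4p29 (R : realType) (k : base_field) (N K : nat)
    (hN : (2 <= N)%N) (hK1 : (1 <= K)%N) (hKN : (K <= N)%N)
    (eta : R) (heta : 0 < eta) :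
  exists G : 'M[scalarF R k]_N,
    Gr K G /\
    forall alpha beta delta : R, 0 < alpha -> 0 < beta -> 0 < delta ->
      riemannian_gradient K (Phi K alpha beta delta eta) G 0.
Proof.
case: N hN hKN => [|[|n]]// _ leK {hK1 heta}.
have [A [AA A_sym trA A_circ]] := circulant_projection_exists R leK.
pose G : 'M[scalarF R k]_n.+2 := map_mx (@ofR R k) A.
have GrG : Gr K G.
  split; first by rewrite /G -map_mxM AA.
    by apply/matrixP => a b; rewrite !mxE conjF_ofR -[in RHS]A_sym mxE.
  by rewrite trace_map_mx trA rmorph_nat.
have G_circ : circulant G by move=> a b c; rewrite !mxE A_circ.
exists G; split=> // alpha beta delta _ _ _; split; first exact: tangent_space0.
move=> g X g_curve g0 gX.
have critical w c := circulant_energy_critical AA A_circ g_curve g0 gX w c.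
have dch : is_derive (0 : R) 1 (fun t => Phi_ch alpha beta (g t)) 0.
  by apply: Phi_ch_critical (sqr_entry_derive g0 gX); rewrite g0.
have dsum : is_derive (0 : R) 1 (fun t => Phi_sum K eta (g t)) 0.
  by under eq_fun do rewrite Phi_sum_energy; exact: critical.
have ddiag : is_derive (0 : R) 1 (fun t => Phi_diag K delta (g t)) 0.
  under eq_fun do rewrite Phi_diag_energy.
  apply: is_derive_eq (is_deriveB (critical _ _) (is_derive_cst _ _ _)) _.
  exact: subr0.
apply: is_derive_eq (is_deriveD (is_deriveD dch ddiag) dsum) _.
by rewrite !addr0 /metric mul0mx mxtrace0; case: (k).
Qed.
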